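(* Let $F=(F_{ij})_{i,j=1}^3\in\mathcal S_1(\mathbb C^3,\mathbb C^3)$ with $\begin{pmatrix}F_{21}(\lambda)\\ F_{31}(\lambda)\end{pmatrix}=\mathbf 0$ for all $\lambda\in\mathbb D$. Then $N_F^{(1)},N_F^{(2)},N_F^{(3)}$ are analytic kernels on $\mathbb D^3$, $N_F^{(1)}$ and $N_F^{(2)}$ are of rank 0, and $(N_F^{(1)},N_F^{(2)},N_F^{(3)})\in\tilde{\mathcal R}_1$. Furthermore, for all $\lambda,\mu\in\mathbb D$ and $\mathbf z,\mathbf w\in\mathbb D^2$, $$N_F^{(i)}(\lambda,\mathbf z,\mu,\mathbf w)=0\ \ (i=1,2),\qquad N_F^{(3)}(\lambda,\mathbf z,\mu,\mathbf w)=\frac{1-\overline{F_{11}(\mu)}F_{11}(\lambda)}{1-\bar\mu\lambda},$$ and $$K_{(N_F^{(1)},N_F^{(2)},N_F^{(3)})}(\lambda,\mathbf z,\mu,\mathbf w)=\overline{F_{11}(\mu)}F_{11}(\lambda).$$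
   Context: $\mathbb D$ is the open unit disc. $\mathcal S_1(\mathbb C^3,\mathbb C^3)$ is the set of analytic $3\times3$ matrix functions $F$ on $\mathbb D$ with $\|F(\lambda)\|\le1$ (operator norm) for all $\lambda\in\mathbb D$. For such $F$, $\lambda\in\mathbb D$ and $\mathbf z=(z_1,z_2)\in\mathbb D^2$ define $$\begin{pmatrix}\tilde\gamma_1(\lambda,\mathbf z)\\ \tilde\gamma_2(\lambda,\mathbf z)\end{pmatrix}=\left(I_2-\begin{pmatrix}F_{22}(\lambda)&F_{23}(\lambda)\\ F_{32}(\lambda)&F_{33}(\lambda)\end{pmatrix}\begin{pmatrix}z_1&0\\ 0&z_2\end{pmatrix}\right)^{-1}\begin{pmatrix}F_{21}(\lambda)\\ F_{31}(\lambda)\end{pmatrix},\qquad \tilde\eta(\lambda,\mathbf z)=\begin{pmatrix}1\\ z_1\tilde\gamma_1(\lambda,\mathbf z)\\ z_2\tilde\gamma_2(\lambda,\mathbf z)\end{pmatrix},$$ and $$N_F^{(i)}(\lambda,\mathbf z,\mu,\mathbf w)=\overline{\tilde\gamma_i(\mu,\mathbf w)}\tilde\gamma_i(\lambda,\mathbf z)\ (i=1,2),\qquad N_F^{(3)}(\lambda,\mathbf z,\mu,\mathbf w)=\tilde\eta(\mu,\mathbf w)^*\frac{I-F(\mu)^*F(\lambda)}{1-\bar\mu\lambda}\tilde\eta(\lambda,\mathbf z).$$ An analytic kernel on $\mathbb D^3$ is a positive semidefinite function $N(\lambda,\mathbf z,\mu,\mathbf w)$ of $(\lambda,\mathbf z),(\mu,\mathbf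 w)\in\mathbb D\times\mathbb D^2=\mathbb D^3$, analytic in $(\lambda,\mathbf z)$ and conjugate-analytic in $(\mu,\mathbf w)$; its rank is the dimension of its reproducing kernel Hilbert space. Put $$K_{(N^{(1)},N^{(2)},N^{(3)})}=1-(1-\bar w_1z_1)N^{(1)}-(1-\bar w_2z_2)N^{(2)}-(1-\bar\mu\lambda)N^{(3)},$$ all functions being evaluated at $(\lambda,\mathbf z,\mu,\mathbf w)$. $\tilde{\mathcal R}_1$ is the set of triples $(N^{(1)},N^{(2)},N^{(3)})$ such that $N^{(1)},N^{(2)},N^{(3)}$ and $K_{(N^{(1)},N^{(2)},N^{(3)})}$ are analytic kernels on $\mathbb D^3$ and $K_{(N^{(1)},N^{(2)},N^{(3)})}$ is of rank 1.
   Formalization: Membership of the triple in R̃₁ is asserted only when F₁₁ is not identically zero on the disc; if F₁₁ ≡ 0 (e.g. F = 0) then K = 0 has rank 0, not 1, so the claim as stated fails there. *)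

(* Defs.v *)
From HB Require Import structures.
From mathcomp Require Import all_boot all_order all_algebra.
From mathcomp Require Import all_classical all_reals all_analysis.
From mathcomp Require Import complex.

Set Implicit Arguments.
Unset Strict Implicit.
Unset Printing Implicit Defensive.

Import Order.TTheory GRing.Theory Num.Theory.
Import numFieldNormedType.Exports.

Local Open Scope classical_set_scope.
Local Open Scope ring_scope.
Local Open Scope sesquilinear_scope.

(* R[i] packaged as a numClosedFieldType: the topology and the normed-module
   structure over itself of MathComp-Analysis are then found by unification. *)
Definition Cplx (R : realType) : numClosedFieldType := R[i].
Arguments Cplx : simpl never.

Section Analytic.
Variable R : realType.
Local Notation C := (Cplx R).

(* Scalars are complex, so differentiability is complex (Frechet)
   differentiability; A is open in all uses. *)
Definition analytic_on (V W : normedModType C) (A : set V) (f : V -> W) : Prop :=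
  forall x, A x -> differentiable f x.

Definition disc : set C := [set l | `|l| < 1].

End Analytic.

Section OperatorNorm.
Variable R : realType.
Local Notation C := (Cplx R).

Definition l2norm n (v : 'cV[C]_n) : R :=
  Num.sqrt (\sum_i ((complex.Re (v i 0)) ^+ 2 + (complex.Im (v i 0)) ^+ 2)).

Definition opnorm m n (A : 'M[C]_(m, n)) : R :=
  sup [set l2norm (A *m v) | v in [set v | l2norm v <= 1]].

Definition schur_class (F : C -> 'M[C]_3) : Prop :=
  analytic_on (@disc R) F /\ forall l, disc l -> opnorm (F l) <= 1.

End OperatorNorm.

(* The convention is K x y = <k_y, k_x> with k_y := K(., y), and inner products
   are linear in the first argument. *)
Section Kernels.
Variables (R : realType) (X : Type).
Local Notation C := (Cplx R).
Implicit Types (K : X -> X -> C) (H : set (X -> C)) (dot : (X -> C) -> (X -> C) -> C).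

Definition psd_kernel K : Prop :=
  forall n (x : 'I_n -> X) (c : 'I_n -> C),
    0 <= \sum_i \sum_j (c i)^* * c j * K (x i) (x j).

(* (H, dot) is a Hilbert space of functions on X; dot is only meaningful on H. *)
Record function_hilbert_space H dot : Prop := {
  fhs0 : H 0;
  fhsP : forall (a : C) f g, H f -> H g -> H (a *: f + g);
  fhs_dotP : forall (a : C) f g h, H f -> H g -> H h ->
    dot (a *: f + g) h = a * dot f h + dot g h;
  fhs_dotC : forall f g, H f -> H g -> dot f g = (dot g f)^*;
  fhs_dot_gt0 : forall f, H f -> f <> 0 -> 0 < dot f f;
  fhs_complete : forall u : nat -> X -> C, (forall n, H (u n)) ->
    (forall e : C, 0 < e -> exists N : nat, forall m n, (N <= m)%N -> (N <= n)%N ->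
       dot (u m - u n) (u m - u n) < e) ->
    exists2 f, H f & (fun n => dot (u n - f) (u n - f)) @ \oo --> (0 : C)
}.

Definition is_rkhs K H dot : Prop :=
  [/\ function_hilbert_space H dot,
      forall y, H (K^~ y) &
      forall f y, H f -> dot f (K^~ y) = f y].

Definition has_dim H (n : nat) : Prop :=
  exists e : 'I_n -> X -> C,
    [/\ forall i, H (e i),
        forall c : 'I_n -> C, \sum_i c i *: e i = 0 -> forall i, c i = 0 &
        forall f, H f -> exists c : 'I_n -> C, f = \sum_i c i *: e i].

Definition kernel_rank K (n : nat) : Prop :=
  exists H dot, is_rkhs K H dot /\ has_dim H n.

End Kernels.

Section Tridisc.
Variable R : realType.
Local Notation C := (Cplx R).

(* A point of C^3 is (lambda, (z1, z2)). *)
Definition pt : Type := (C * (C * C))%type.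

Definition bidisc : set (C * C) := @disc R `*` @disc R.
Definition tridisc : set (C * (C * C)) := @disc R `*` bidisc.

Definition kernelD3 : Type := pt -> pt -> C.

(* Kernels are total functions; only their values on the tridisc matter. *)
Definition on_tridisc (N : kernelD3) : tridisc -> tridisc -> C :=
  fun p q => N (\val p) (\val q).

Definition analytic_kernel (N : kernelD3) : Prop :=
  [/\ psd_kernel (on_tridisc N),
      forall q, tridisc q -> analytic_on tridisc (fun p : C * (C * C) => N p q) &
      forall p, tridisc p ->
        analytic_on tridisc (fun q : C * (C * C) => (N p q)^*)].

Definition rankD3 (N : kernelD3) (n : nat) : Prop := kernel_rank (on_tridisc N) n.

Definition Kof (N1 N2 N3 : kernelD3) : kernelD3 := fun p q =>
  let: (l, (z1, z2)) := p in
  let: (m, (w1, w2)) := q in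
  1 - (1 - w1^* * z1) * N1 p q - (1 - w2^* * z2) * N2 p q
    - (1 - m^* * l) * N3 p q.

Definition R1tilde : set (kernelD3 * kernelD3 * kernelD3) :=
  [set N | let: (N1, N2, N3) := N in
    [/\ analytic_kernel N1, analytic_kernel N2, analytic_kernel N3,
        analytic_kernel (Kof N1 N2 N3) & rankD3 (Kof N1 N2 N3) 1]].

End Tridisc.

Section KernelsOfF.
Variables (R : realType).
Local Notation C := (Cplx R).
Variable F : C -> 'M[C]_3.

(* F(l) as a block matrix for C^3 = C + C^2. *)
Definition Fblk (l : C) : 'M[C]_(1 + 2) := F l.

Definition F11 (l : C) : C := F l 0 0.

Definition gammaF (l : C) (z : C * C) : 'cV[C]_2 :=
  invmx (1%:M - drsubmx (Fblk l) *m diag_mx (\row_j [:: z.1; z.2]`_j))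
    *m dlsubmx (Fblk l).

Definition gamma1 l z : C := gammaF l z 0 0.
Definition gamma2 l z : C := gammaF l z 1 0.

Definition etaF (l : C) (z : C * C) : 'cV[C]_3 :=
  \col_i [:: 1; z.1 * gamma1 l z; z.2 * gamma2 l z]`_i.

Definition NF1 : kernelD3 R := fun p q => (gamma1 q.1 q.2)^* * gamma1 p.1 p.2.
Definition NF2 : kernelD3 R := fun p q => (gamma2 q.1 q.2)^* * gamma2 p.1 p.2.

Definition NF3 : kernelD3 R := fun p q =>
  ((etaF q.1 q.2) ^t* *m
     ((1 - q.1^* * p.1)^-1 *: (1%:M - (F q.1) ^t* *m F p.1)) *m
   etaF p.1 p.2) 0 0.

End KernelsOfF.

(* Main.v *)
Require Import Defs.
From mathcomp Require Import all_boot all_order all_algebra.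
From mathcomp Require Import all_classical all_reals all_analysis.
From mathcomp Require Import complex.
From mathcomp Require Import ring lra.

(** When the block [(F21, F31)] vanishes, so does [gammaF], and [etaF] is the
    first basis vector; the formulas for the kernels are then a computation
    ([NF3E], [KofE]), in which [F11] is the only entry of [F] left. The first two
    kernels are zero, and the fourth one is [(F11 m)^* * F11 l], which is visibly
    positive, with reproducing kernel Hilbert space the line spanned by [F11]
    ([kernel_rank1]).

    The substance is the positivity of the third kernel, the de Branges-Rovnyak
    kernel of [f = F11]. As an entry of a contraction, [f] is analytic and bounded
    by [1] on the disc, and the claim is the necessity half of Pick's theorem
    ([pick_matrix_ge0]). Its classical proof takes place in the Hardy space:
    multiplication by [f] is a contraction, and its adjoint maps the Szego kernel
    at [x] to [(f x)^*] times itself. The only analytic input is Cauchy's formula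
    for the pairing of an analytic function with a Szego kernel.

    Here analytic means complex differentiable at every point, with no continuity
    of the derivative, so Cauchy's formula requires Goursat's argument. It is
    carried out without integrals: the circle measure is replaced by the mean over
    the roots of unity of order [2 ^ n], and contour integrals by trapezoid sums.
    These are exactly additive under bisection and vanish exactly for affine
    integrands on closed contours, which is all that the bisection uses
    ([loop_cvg0]). Applied to the contraction of the unit circle towards a point
    [x], it yields the Cauchy formula in the limit ([avg_szego_cvg]), and the Hardy
    space argument becomes the nonnegativity of a mean of nonnegative numbers
    ([pick_matrix_ge0_closed]). *)

Import Order.TTheory GRing.Theory Num.Theory.
Import numFieldNormedType.Exports.
Local Open Scope ring_scope.

Set Implicit Arguments.
Unset Strict Implicit.
Unset Printing Implicit Defensive.

(** * Real scalars and limits in the complex field *)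

Section RealScalars.
Variable R : realType.
Local Notation C := (Cplx R).

(** The order of [C] is partial and its norm is [C]-valued; estimates are
    carried out in the totally ordered field [R] and transported by this map. *)
Definition RtoC : {rmorphism R -> C} := real_complex R.

Lemma RtoC_ge0 (x : R) : (0 <= RtoC x) = (0 <= x).
Proof. exact: (lecR 0 x). Qed.

Lemma RtoC_gt0 (x : R) : (0 < RtoC x) = (0 < x).
Proof. exact: (ltcR 0 x). Qed.

Lemma ler_RtoC : {mono RtoC : x y / x <= y}.
Proof. move=> x y; exact: lecR. Qed.

Lemma ltr_RtoC : {mono RtoC : x y / x < y}.
Proof. move=> x y; exact: ltcR. Qed.

Lemma normr_RtoC (x : R) : `|RtoC x| = RtoC `|x|.
Proof.
have [x0|x0] := leP 0 x; first by rewrite !ger0_norm ?RtoC_ge0.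
by rewrite !ltr0_norm -?rmorphN // -(rmorph0 RtoC) ltr_RtoC.
Qed.

Lemma real_RtoC (x : C) : x \is Num.real -> exists r, x = RtoC r.
Proof. by move/complex_realP. Qed.

Lemma cvg_conj (u : nat -> C) (l : C) :
  (u n @[n --> \oo] --> l)%classic -> ((u n)^* @[n --> \oo] --> l^*)%classic.
Proof.
move=> /cvgrPdist_le ul; apply/cvgrPdist_le => e /ul.
by apply: filterS => n; rewrite -rmorphB norm_conjC.
Qed.

Lemma cvg_RtoC (u : nat -> R) (l : R) :
  (u n @[n --> \oo] --> l)%classic -> (RtoC (u n) @[n --> \oo] --> RtoC l)%classic.
Proof.
move=> /cvgrPdist_le ul; apply/cvgrPdist_le => e0 e0gt.
have [e eE] := real_RtoC (gtr0_real e0gt); rewrite {}eE RtoC_gt0 in e0gt *.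
have := ul e e0gt.
by apply: filterS => n; rewrite -rmorphB normr_RtoC ler_RtoC.
Qed.

(** A sequence of nonnegative complex numbers is equal to the sequence of its
    norms, so its limit is its own norm. *)
Lemma cvg_ge0 (u : nat -> C) (l : C) :
  (forall n, 0 <= u n) -> (u n @[n --> \oo] --> l)%classic -> 0 <= l.
Proof.
move=> u0 ul; have -> : l = `|l|; last exact: normr_ge0.
apply: (cvg_unique (@norm_hausdorff _ _) ul).
have -> : u = fun n => `|u n| by apply/funext => n; rewrite ger0_norm.
exact: cvg_norm.
Qed.

Lemma cvg_sum m (u : 'I_m -> nat -> C) (l : 'I_m -> C) :
  (forall i, (u i n @[n --> \oo] --> l i)%classic) ->
  (\sum_i u i n @[n --> \oo] --> \sum_i l i)%classic.
Proof. by move=> ul; apply: cvg_big => // x; exact: add_continuous. Qed.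

Lemma norm_RtoC_le_rect (x y : R) :
  `|RtoC x| <= `|RtoC x + 'i * RtoC y| /\ `|RtoC y| <= `|RtoC x + 'i * RtoC y|.
Proof.
have rl (t : R) : RtoC t \is Num.real by apply/complex_realP; exists t.
have sq : `|RtoC x + 'i * RtoC y| ^+ 2 = `|RtoC x| ^+ 2 + `|RtoC y| ^+ 2.
  by rewrite normC2_rect// !real_normK.
by split; rewrite -(@ler_pXn2r _ 2)// ?nnegrE// sq ?lerDl ?lerDr exprn_ge0.
Qed.

(** Completeness of [C] comes from that of [R] applied to the real and the
    imaginary part. *)
Lemma Cplx_cauchy_cvg (a : nat -> C) :
  (forall e : C, 0 < e -> exists N, forall m n, (N <= m)%N -> (N <= n)%N ->
     `|a m - a n| < e) ->
  exists l : C, (a n @[n --> \oo] --> l)%classic.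
Proof.
move=> ca.
pose x n := complex.Re (a n); pose y n := complex.Im (a n).
have aE n : a n = RtoC (x n) + 'i * RtoC (y n) by exact: complexE.
have dE m n : a m - a n = RtoC (x m - x n) + 'i * RtoC (y m - y n).
  by rewrite !aE !rmorphB; ring.
have real_cvg (u : nat -> R) : (forall m n, `|RtoC (u m - u n)| <= `|a m - a n|) ->
    exists l : R, (u n @[n --> \oo] --> l)%classic.
  move=> ua; have cu : cauchy (u n @[n --> \oo])%classic; last first.
    by apply/cvg_ex; exact: cauchy_cvg cu.
  apply: cauchy_exP => e e0.
  have /ca[N hN] : 0 < RtoC e by rewrite RtoC_gt0.
  exists (u N); exists N => // n /= Nn.
  rewrite -ball_normE/= -ltr_RtoC -normr_RtoC.
  by apply: le_lt_trans (ua _ _) _; exact: hN.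
have [lx xl] : exists l : R, (x n @[n --> \oo] --> l)%classic.
  by apply: real_cvg => m n; rewrite dE; have [] := norm_RtoC_le_rect (x m - x n) (y m - y n).
have [ly yl] : exists l : R, (y n @[n --> \oo] --> l)%classic.
  by apply: real_cvg => m n; rewrite dE; have [] := norm_RtoC_le_rect (x m - x n) (y m - y n).
exists (RtoC lx + 'i * RtoC ly); rewrite (funext aE).
apply: cvgD; first exact: cvg_RtoC.
by apply: cvgM; [exact: cvg_cst | exact: cvg_RtoC].
Qed.

End RealScalars.

(** * Trapezoid sums along the boundary of a curvilinear square *)

Section TrapezoidSums.
Variable R : realType.
Local Notation C := (Cplx R).
Local Notation RtoC := (RtoC R).
Implicit Types (g : C -> C) (c : R -> C) (phi : R -> R -> C).

Definition node (n k : nat) : R := k%:R / 2 ^+ n.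

(** A contour integral of [g] along [c : [0, 1] -> C], replaced by its trapezoid
    sum over the [n]-th dyadic subdivision. No limit is needed for the two
    properties that matter: exact additivity under halving ([trapezoidS]) and
    exactness on affine integrands ([trapezoid_affine]). *)
Definition trapezoid g n c : C :=
  \sum_(0 <= k < 2 ^ n) (g (c (node n k)) + g (c (node n k.+1))) / 2 *
    (c (node n k.+1) - c (node n k)).

Lemma node_ge0 n k : 0 <= node n k.
Proof. by rewrite divr_ge0 ?exprn_ge0. Qed.

Lemma node_le1 n k : (k <= 2 ^ n)%N -> node n k <= 1.
Proof. by move=> kn; rewrite ler_pdivrMr ?exprn_gt0// mul1r -natrX ler_nat. Qed.

Lemma node_top n : node n (2 ^ n) = 1.
Proof. by rewrite /node natrX divff ?expf_neq0 ?pnatr_eq0. Qed.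

Lemma trapezoidS g n c :
  trapezoid g n.+1 c =
  trapezoid g n (fun t => c (t / 2)) + trapezoid g n (fun t => c ((t + 1) / 2)).
Proof.
have l k : node n k / 2 = node n.+1 k by rewrite /node exprSr invfM mulrA.
have r k : (node n k + 1) / 2 = node n.+1 (k + 2 ^ n).
  rewrite -l; congr (_ / 2).
  by rewrite /node natrD mulrDl natrX divff ?expf_neq0 ?pnatr_eq0.
rewrite /trapezoid expnS mul2n -addnn.
rewrite (@big_cat_nat _ _ _ (2 ^ n)%N) ?leq_addr//=; congr (_ + _).
  by apply: eq_bigr => k _; rewrite !l.
rewrite -{1}[(2 ^ n)%N]add0n big_addn addnK.
by apply: eq_bigr => k _; rewrite !r !addSn.
Qed.

Lemma trapezoidD g1 g2 n c :
  trapezoid (fun z => g1 z + g2 z) n c = trapezoid g1 n c + trapezoid g2 n c.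
Proof. by rewrite /trapezoid -big_split/=; apply: eq_bigr => k _; ring. Qed.

(** On an edge from [u] to [v] the trapezoid rule gives
    [a * (v - u) + b / 2 * (v ^+ 2 - u ^+ 2)], so the sum telescopes; on a closed
    contour it vanishes. *)
Lemma trapezoid_affine (a b : C) n c :
  trapezoid (fun z => a + b * z) n c =
  (a * c 1 + b / 2 * c 1 ^+ 2) - (a * c 0 + b / 2 * c 0 ^+ 2).
Proof.
pose P k := a * c (node n k) + b / 2 * c (node n k) ^+ 2.
have -> : trapezoid (fun z => a + b * z) n c =
    \sum_(0 <= k < 2 ^ n) (P k.+1 - P k).
  by apply: eq_bigr => k _; rewrite /P; field.
by rewrite telescope_sumr// /P node_top /node mul0r.
Qed.

Lemma trapezoid_le g n c (A B : R) :
  (forall t, 0 <= t <= 1 -> `|g (c t)| <= RtoC A) ->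
  (forall s t, 0 <= s <= 1 -> 0 <= t <= 1 ->
     `|c s - c t| <= RtoC (B * `|s - t|)) ->
  `|trapezoid g n c| <= RtoC (A * B).
Proof.
move=> gA cB; apply: le_trans (ler_norm_sum _ _ _) _.
have -> : RtoC (A * B) = \sum_(0 <= k < 2 ^ n) RtoC (A * B / 2 ^+ n).
  rewrite big_const_nat subn0 iter_addr addr0 -rmorphMn/= -mulr_natr natrX.
  by rewrite divfK ?expf_neq0 ?pnatr_eq0.
rewrite big_nat_cond [leRHS]big_nat_cond; apply: ler_sum => k /andP[/andP[_ kn] _].
have k01 : 0 <= node n k <= 1 by rewrite node_ge0 node_le1// ltnW.
have k101 : 0 <= node n k.+1 <= 1 by rewrite node_ge0 node_le1.
rewrite -[A * B / _]mulrA rmorphM/= normrM; apply: ler_pM => //.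
  rewrite normrM normfV normr_nat ler_pdivrMr ?ltr0n// mulr_natr mulr2n.
  by apply: le_trans (ler_normD _ _) _; apply: lerD; apply: gA.
apply: le_trans (cB _ _ k101 k01) _; rewrite ler_RtoC le_eqVlt; apply/orP; left.
have -> : node n k.+1 - node n k = 1 / 2 ^+ n.
  by rewrite /node -mulrBl -natrB// subSnn.
by rewrite ger0_norm ?mul1r// invr_ge0 exprn_ge0.
Qed.

(** The trapezoid sum of [g] around the image under [phi] of the boundary of the
    square [[a, a + l] x [b, b + l]]. *)
Definition loop g phi n (a b l : R) : C :=
  trapezoid g n (fun t => phi (a + l * t) b)
  + trapezoid g n (fun t => phi (a + l) (b + l * t))
  - trapezoid g n (fun t => phi (a + l * t) (b + l))
  - trapezoid g n (fun t => phi a (b + l * t)).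

(** Contributions of the sides shared by two of the four quarters cancel. *)
Lemma loopS g phi n a b l :
  loop g phi n.+1 a b l =
  loop g phi n a b (l / 2) + loop g phi n (a + l / 2) b (l / 2)
  + loop g phi n a (b + l / 2) (l / 2)
  + loop g phi n (a + l / 2) (b + l / 2) (l / 2).
Proof.
have h1 u t : u + l * (t / 2) = u + l / 2 * t :> R by ring.
have h2 u t : u + l * ((t + 1) / 2) = u + l / 2 + l / 2 * t :> R by ring.
have h3 u : u + l / 2 + l / 2 = u + l :> R by field.
have E f1 f2 : f1 =1 f2 -> trapezoid g n f1 = trapezoid g n f2.
  by move=> /funext->.
rewrite /loop !trapezoidS.
rewrite !(E _ _ (fun t => congr1 (phi ^~ _) (h1 _ t))).
rewrite !(E _ _ (fun t => congr1 (phi ^~ _) (h2 _ t))).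
rewrite !(E _ _ (fun t => congr1 (phi _) (h1 _ t))).
rewrite !(E _ _ (fun t => congr1 (phi _) (h2 _ t))).
rewrite !h3; ring.
Qed.

Lemma loopD g1 g2 phi n a b l :
  loop (fun z => g1 z + g2 z) phi n a b l =
  loop g1 phi n a b l + loop g2 phi n a b l.
Proof. by rewrite /loop !trapezoidD; ring. Qed.

Lemma loop_affine (p q : C) phi n a b l :
  loop (fun z => p + q * z) phi n a b l = 0.
Proof. by rewrite /loop !trapezoid_affine !mulr1 !mulr0 !addr0; ring. Qed.

Definition unit_square_lipschitz phi (L : R) :=
  forall s t s' t', 0 <= s <= 1 -> 0 <= t <= 1 -> 0 <= s' <= 1 -> 0 <= t' <= 1 ->
  `|phi s t - phi s' t'| <= RtoC (L * (`|s - s'| + `|t - t'|)).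

Lemma loop_le g phi n a b l (A L : R) :
  unit_square_lipschitz phi L ->
  0 <= a -> 0 <= b -> 0 <= l -> a + l <= 1 -> b + l <= 1 ->
  (forall s t, a <= s <= a + l -> b <= t <= b + l ->
     `|g (phi s t)| <= RtoC A) ->
  `|loop g phi n a b l| <= RtoC (4 * (A * (L * l))).
Proof.
move=> phiL a0 b0 l0 al bl gA.
have in1 u t : 0 <= u -> u + l <= 1 -> 0 <= t <= 1 -> 0 <= u + l * t <= 1.
  by move=> *; apply/andP; split; nra.
have in2 u t : 0 <= t <= 1 -> u <= u + l * t <= u + l.
  by move=> *; apply/andP; split; nra.
have dl (u s t : R) : `|u + l * s - (u + l * t)| = l * `|s - t|.
  by rewrite -[l in RHS]ger0_norm// -normrM; congr `|_|; ring.
have H u v : 0 <= u <= 1 -> 0 <= v <= 1 ->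
    (forall s t, 0 <= s <= 1 -> 0 <= t <= 1 ->
      `|phi u (b + l * s) - phi u (b + l * t)| <= RtoC (L * l * `|s - t|)) /\
    (forall s t, 0 <= s <= 1 -> 0 <= t <= 1 ->
      `|phi (a + l * s) v - phi (a + l * t) v| <= RtoC (L * l * `|s - t|)).
  move=> u1 v1; split=> s t s1 t1; apply: le_trans (phiL _ _ _ _ _ _ _ _) _ => //;
    by rewrite ?in1// dl subrr normr0 ?addr0 ?add0r mulrA.
have a1 : 0 <= a <= 1 by apply/andP; split; lra.
have b1 : 0 <= b <= 1 by apply/andP; split; lra.
have al1 : 0 <= a + l <= 1 by apply/andP; split; lra.
have bl1 : 0 <= b + l <= 1 by apply/andP; split; lra.
have aa : a <= a <= a + l by apply/andP; split; lra.
have bb : b <= b <= b + l by apply/andP; split; lra.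
have aa' : a <= a + l <= a + l by apply/andP; split; lra.
have bb' : b <= b + l <= b + l by apply/andP; split; lra.
have -> : RtoC (4 * (A * (L * l))) =
  RtoC (A * (L * l)) + RtoC (A * (L * l)) + RtoC (A * (L * l)) + RtoC (A * (L * l)).
  by rewrite -!rmorphD; congr (RtoC _); ring.
have tri (x y z w : C) : `|x + y - z - w| <= `|x| + `|y| + `|z| + `|w|.
  apply: le_trans (ler_normB _ _) _; rewrite lerD2r.
  by apply: le_trans (ler_normB _ _) _; rewrite lerD2r ler_normD.
apply: le_trans (tri _ _ _ _) _.
do !apply: lerD; apply: trapezoid_le.
- by move=> t t1; apply: gA => //; exact: in2.
- by have [] := H a b a1 b1.
- by move=> t t1; apply: gA => //; exact: in2.
- by have [] := H (a + l) b al1 b1.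
- by move=> t t1; apply: gA => //; exact: in2.
- by have [] := H a (b + l) a1 bl1.
- by move=> t t1; apply: gA => //; exact: in2.
- by have [] := H a b a1 b1.
Qed.

End TrapezoidSums.

(** * Goursat's bisection argument *)

Section Goursat.
Variable R : realType.
Local Notation C := (Cplx R).
Local Notation RtoC := (RtoC R).

Lemma differentiable_tangent (g : C -> C) (z : C) : differentiable g z ->
  exists c : C, forall e : R, 0 < e -> exists2 d : R, 0 < d &
    forall w, `|w - z| < RtoC d ->
      `|g w - (g z + c * (w - z))| <= RtoC e * `|w - z|.
Proof.
move=> dg; exists ('d g z 1) => e e0.
have /eqaddoP/(_ (RtoC e)) := diff_locally dg; rewrite RtoC_gt0 => /(_ e0).
move=> /nbhs_ballP[d /= d0 H].
have [r dr] := real_RtoC (gtr0_real d0).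
exists r; first by rewrite -RtoC_gt0 -dr.
move=> w wr; have /= := H (w - z).
rewrite -ball_normE/= sub0r normrN dr => /(_ wr).
rewrite !fctE /= subrK; congr (`|_ - (_ + _)| <= _).
by rewrite -[w - z in LHS]mulr1 -[_ * 1]/(_ *: _) linearZ/= mulrC.
Qed.

Lemma nested_intervals (a : nat -> R) :
  (forall n, a n <= a n.+1 /\ a n.+1 + 2 ^- n.+1 <= a n + 2 ^- n) ->
  exists x, forall n, a n <= x <= a n + 2 ^- n.
Proof.
move=> aS.
have mono m n : (m <= n)%N -> a m <= a n /\ a n + 2 ^- n <= a m + 2 ^- m.
  move=> /subnK <-; elim: (n - m)%N => [|k [ih1 ih2]]; first by rewrite add0n.
  have [h1 h2] := aS (k + m)%N; rewrite addSn.
  by split; [exact: le_trans h1 | exact: le_trans ih2].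
have cross m n : a m <= a n + 2 ^- n.
  have p k : a k <= a k + 2 ^- k by rewrite lerDl invr_ge0 exprn_ge0.
  have [/mono[h _]|/ltnW/mono[_ h]] := leqP m n; first exact: le_trans (p n).
  exact: le_trans (p m) h.
have hs : has_sup (range a).
  split; first by exists (a 0%N), 0%N.
  by exists (a 0%N + 2 ^- 0) => _ [m _ <-].
exists (sup (range a)) => n; apply/andP; split.
  by apply: sup_upper_bound => //; exists n.
by apply: ge_sup => [|_ [m _ <-]]; [case: hs | exact: cross].
Qed.

(** Goursat's theorem for trapezoid sums. If the bound [e * l ^+ 2] fails for
    arbitrarily large [n] on a square, it fails on one of its quarters. The nested
    failing squares shrink to a point where [g] has a tangent affine map; since
    loops of affine maps vanish exactly, only the remainder is left on a
    small square, and it obeys the bound for every [n]. *)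
Lemma loop_cvg0 (g : C -> C) (phi : R -> R -> C) (L : R) :
  unit_square_lipschitz phi L -> 0 < L ->
  (forall s t, 0 <= s <= 1 -> 0 <= t <= 1 -> differentiable g (phi s t)) ->
  forall e : R, 0 < e -> exists N, forall n, (N <= n)%N ->
    `|loop g phi n 0 0 1| <= RtoC e.
Proof.
move=> phiL L0 dg e e0.
(* The bound is proportional to the area so that it adds up over quarters. *)
pose good (a b l : R) := exists N, forall n, (N <= n)%N ->
  `|loop g phi n a b l| <= RtoC (e * l ^+ 2).
suff : good 0 0 1 by rewrite /good expr1n mulr1.
have merge a b l : good a b (l / 2) -> good (a + l / 2) b (l / 2) ->
    good a (b + l / 2) (l / 2) -> good (a + l / 2) (b + l / 2) (l / 2) ->
    good a b l.
  move=> [N1 h1] [N2 h2] [N3 h3] [N4 h4].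
  exists (maxn (maxn N1 N2) (maxn N3 N4)).+1 => -[//|n].
  rewrite ltnS !geq_max => /andP[/andP[n1 n2] /andP[n3 n4]].
  rewrite loopS.
  have -> : RtoC (e * l ^+ 2) = RtoC (e * (l / 2) ^+ 2) + RtoC (e * (l / 2) ^+ 2)
      + RtoC (e * (l / 2) ^+ 2) + RtoC (e * (l / 2) ^+ 2).
    by rewrite -!rmorphD; congr (RtoC _); field.
  apply: le_trans (ler_normD _ _) _; apply: lerD; last exact: h4.
  apply: le_trans (ler_normD _ _) _; apply: lerD; last exact: h3.
  by apply: le_trans (ler_normD _ _) _; apply: lerD; [exact: h1 | exact: h2].
apply: contrapT => bad0.
pose bad (m : nat) (p : R * R) := ~ good p.1 p.2 (2 ^- m).
pose sub1 (a' : R) m' (a : R) m := a <= a' /\ a' + 2 ^- m' <= a + 2 ^- m.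
have step (q : nat * (R * R)) : {q' : nat * (R * R) | q'.1 = q.1.+1 /\
    (bad q.1 q.2 -> [/\ bad q'.1 q'.2, sub1 q'.2.1 q'.1 q.2.1 q.1 &
      sub1 q'.2.2 q'.1 q.2.2 q.1])}.
  apply/cid; case: q => m [a b] /=.
  have [bad1|] := pselect (bad m (a, b)); last by exists (m.+1, (a, b)).
  have hl : 2 ^- m / 2 = 2 ^- m.+1 :> R by rewrite exprSr invfM.
  have l0 : 0 < 2 ^- m.+1 :> R by rewrite invr_gt0 exprn_gt0.
  have hl2 : 2 ^- m = 2 ^- m.+1 + 2 ^- m.+1 :> R by rewrite -hl; field.
  have s0 u : sub1 u m.+1 u m by split; lra.
  have s1 u : sub1 (u + 2 ^- m.+1) m.+1 u m by split; lra.
  have [g1|b1] := pselect (good a b (2 ^- m.+1)); last by exists (m.+1, (a, b)).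
  have [g2|b2] := pselect (good (a + 2 ^- m.+1) b (2 ^- m.+1)); last first.
    exists (m.+1, (a + 2 ^- m.+1, b)); split=> // _.
    by split; [exact: b2 | exact: s1 | exact: s0].
  have [g3|b3] := pselect (good a (b + 2 ^- m.+1) (2 ^- m.+1)); last first.
    exists (m.+1, (a, b + 2 ^- m.+1)); split=> // _.
    by split; [exact: b3 | exact: s0 | exact: s1].
  exists (m.+1, (a + 2 ^- m.+1, b + 2 ^- m.+1)); split=> // _; split.
  - by move=> g4; apply: bad1; apply: merge; rewrite /= hl.
  - exact: s1.
  - exact: s1.
have [q [q0 qS]] := dependent_choice step (0%N, (0, 0)).
have q1 m : (q m).1 = m by elim: m => [|m ih]; rewrite ?q0// (qS m).1 ih.
have qbad m : bad m (q m).2.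
  elim: m => [|m ih]; first by rewrite /bad q0 expr0 invr1.
  by have := (qS m).2; rewrite !q1 => /(_ ih)[].
have qa m : sub1 (q m.+1).2.1 m.+1 (q m).2.1 m.
  by have := (qS m).2; rewrite !q1 => /(_ (qbad m))[].
have qb m : sub1 (q m.+1).2.2 m.+1 (q m).2.2 m.
  by have := (qS m).2; rewrite !q1 => /(_ (qbad m))[].
have [s sP] := nested_intervals qa.
have [t tP] := nested_intervals qb.
have bnd (a : nat -> R) : a 0%N = 0 -> (forall m, sub1 (a m.+1) m.+1 (a m) m) ->
    forall m, 0 <= a m /\ a m + 2 ^- m <= 1.
  move=> a0 aS; elim=> [|m [h1 h2]]; first by rewrite a0 add0r expr0 invr1.
  by have [h3 h4] := aS m; split; [exact: le_trans h3 | exact: le_trans h2].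
have ba := bnd (fun m => (q m).2.1) (congr1 (fun p => p.2.1) q0) qa.
have bb := bnd (fun m => (q m).2.2) (congr1 (fun p => p.2.2) q0) qb.
have s1 : 0 <= s <= 1.
  by have := sP 0%N; rewrite q0 /= expr0 invr1 add0r.
have t1 : 0 <= t <= 1.
  by have := tP 0%N; rewrite q0 /= expr0 invr1 add0r.
have [c /(_ (e / (8 * L ^+ 2)))] := differentiable_tangent (dg _ _ s1 t1).
have e'0 : 0 < e / (8 * L ^+ 2) by rewrite divr_gt0// mulr_gt0// exprn_gt0.
move=> /(_ e'0)[d d0 tang].
have d'0 : 0 < d / (2 * L) by rewrite divr_gt0// mulr_gt0.
have [m _ /(_ m (leqnn m))] := near_infty_natSinv_expn_lt (PosNum d'0).
rewrite /= div1r => md.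
apply: (qbad m); exists 0%N => n _.
set a := (q m).2.1; set b := (q m).2.2; set l : R := 2 ^- m.
have l0 : 0 < l by rewrite invr_gt0 exprn_gt0.
set z := phi s t in tang.
have [a0 al] := ba m; have [b0 bl] := bb m.
pose r w := g w - (g z + c * (w - z)).
have -> : loop g phi n a b l = loop r phi n a b l.
  have gE : g = fun w => r w + (g z - c * z + c * w).
    by apply/funext => w; rewrite /r; ring.
  by rewrite {1}gE loopD loop_affine addr0.
(* Four sides, of length at most [L * l] each, on which the remainder is at most
   [e / (8 * L ^+ 2)] times a distance at most [L * (2 * l)]. *)
have -> : e * l ^+ 2 = 4 * (e / (8 * L ^+ 2) * (L * (2 * l)) * (L * l)).
  by field; rewrite gt_eqF.
apply: loop_le => //; first exact: ltW.
move=> s' t' hs' ht'.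
have /andP[sa sal] := sP m; have /andP[tb tbl] := tP m.
have near : `|phi s' t' - z| <= RtoC (L * (2 * l)).
  apply: le_trans (phiL _ _ _ _ _ _ _ _) _ => //.
  - by apply/andP; split; rewrite -/a -/b -/l in a0 al *; lra.
  - by apply/andP; split; rewrite -/a -/b -/l in b0 bl *; lra.
  rewrite ler_RtoC ler_pM2l// mulr2n mulrDl mul1r; apply: lerD.
    by rewrite ler_distl -/l in sal *; apply/andP; split; lra.
  by rewrite ler_distl -/l in tbl *; apply/andP; split; lra.
apply: le_trans (tang _ _) _.
  apply: le_lt_trans near _; rewrite ltr_RtoC.
  by move: md; rewrite -/l ltr_pdivlMr ?mulr_gt0// => md; nra.
by rewrite [leRHS]rmorphM ler_pM2l ?RtoC_gt0.
Qed.

End Goursat.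

(** * Dyadic roots of unity *)

Section UnitCircle.
Variable R : realType.
Local Notation C := (Cplx R).
Local Notation RtoC := (RtoC R).

Definition cis (t : R) : C := RtoC (cos t) + 'i * RtoC (sin t).

Lemma cisD s t : cis (s + t) = cis s * cis t.
Proof.
have i2 : 'i * 'i = -1 :> C by rewrite -expr2 sqrCi.
rewrite /cis cosD sinD !(rmorphD, rmorphB, rmorphM)/=.
ring: i2.
Qed.

Lemma cis0 : cis 0 = 1.
Proof. by rewrite /cis cos0 sin0 rmorph1 rmorph0 mulr0 addr0. Qed.

Lemma cis2pi : cis (pi *+ 2) = 1.
Proof. by rewrite /cis cos2pi sin2pi rmorph1 rmorph0 mulr0 addr0. Qed.

Lemma norm_cis t : `|cis t| = 1.
Proof.
apply/eqP; rewrite -(@eqrXn2 _ 2)// normC2_rect ?rmorph_real//.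
- by rewrite -!rmorphXn -rmorphD/= cos2Dsin2 rmorph1 expr1n.
- by apply/complex_realP; exists (cos t).
- by apply/complex_realP; exists (sin t).
Qed.

Lemma cis_neq0 t : cis t != 0.
Proof. by rewrite -normr_gt0 norm_cis. Qed.

Lemma cisV t : (cis t)^-1 = cis (- t).
Proof. by apply: (mulfI (cis_neq0 t)); rewrite divff ?cis_neq0// -cisD subrr cis0. Qed.

Lemma cis_lipschitz s t : `|cis s - cis t| <= RtoC (2 * `|s - t|).
Proof.
have mvt (f df : R^o -> R^o) : (forall x, is_derive (x : R^o) 1 f (df x)) ->
    (forall x, `|df x| <= 1) -> `|f s - f t| <= `|s - t|.
  move=> fd df1; wlog st : s t / s <= t.
    move=> H; have [|/ltW] := leP s t; first exact: H.
    by move/H; rewrite distrC [`|t - s|]distrC.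
  have [|c _ fE] := @MVT_segment _ f df s t st (fun x _ => fd x).
    apply: continuous_subspaceT => x.
    apply: differentiable_continuous; apply/derivable1_diffP.
    by have [] := fd x.
  by rewrite distrC fE normrM [`|s - t|]distrC ler_piMl.
have hs := mvt _ _ (@is_derive_sin R) (@cos_max R).
have hc : `|cos s - cos t| <= `|s - t|.
  by apply: mvt (@is_derive_cos R) _ => x; rewrite normrN sin_max.
have -> : cis s - cis t = RtoC (cos s - cos t) + 'i * RtoC (sin s - sin t).
  by rewrite /cis !rmorphB/=; ring.
apply: le_trans (ler_normD _ _) _; rewrite normrM normCi mul1r !normr_RtoC.
by rewrite -rmorphD ler_RtoC mulr2n mulrDl mul1r lerD.
Qed.

Definition unit_root (n k : nat) : C := cis (pi *+ 2 * node R n k).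

(** The mean over the roots of unity of order [2 ^ n]: it plays the role of the
    normalized arc length measure of the unit circle, and [avg n (h * k^* )] that
    of the inner product of the Hardy space. *)
Definition avg (n : nat) (h : C -> C) : C :=
  (2 ^+ n)^-1 * \sum_(0 <= k < 2 ^ n) h (unit_root n k).

Lemma unit_rootS n k : unit_root n k.+1 = unit_root n k * unit_root n 1.
Proof. by rewrite /unit_root -cisD -mulrDr /node -mulrDl -natrD addn1. Qed.

Lemma norm_unit_root n k : `|unit_root n k| = 1. Proof. exact: norm_cis. Qed.

(** Doubling the angle at most doubles the sine, so [2 ^+ n * sin (2 pi / 2 ^+ n)]
    is nondecreasing in [n], and its value at [n = 2] is [4]. This keeps [2 ^+ n]
    times the weight in [trapezoid_circle] away from [0]. *)
Lemma sin_unit_root_ge n : (2 <= n)%N -> 4 <= 2 ^+ n * sin (pi *+ 2 * node R n 1) :> R.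
Proof.
move=> /subnK <-; elim: (n - 2)%N => [|k ih].
  rewrite add0n /node.
  have -> : pi *+ 2 * (1%:R / 2 ^+ 2) = pi / 2 :> R by field.
  by rewrite sin_pihalf mulr1 expr2 -natrM.
apply: le_trans ih _; rewrite addSn.
set x : R := pi *+ 2 * node R (k + 2).+1 1.
have -> : pi *+ 2 * node R (k + 2) 1 = x *+ 2.
  by rewrite /x /node exprS; field; rewrite expf_neq0.
have x0 : 0 <= x <= pi.
  rewrite /x /node mul1r; apply/andP; split.
    by rewrite mulr_ge0 ?invr_ge0 ?exprn_ge0// mulrn_wge0// pi_ge0.
  rewrite -[pi *+ 2]mulr_natr -mulrA ger_pMr ?pi_gt0// ler_pdivrMr ?exprn_gt0// mul1r.
  by rewrite exprS ler_peMr// exprn_ege1// ler1n.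
have /andP[x1 x2] := x0.
rewrite sin_mulr2n [X in _ <= X * _]exprS [2 * _]mulrC -mulrA ler_pM2l ?exprn_gt0//.
rewrite -[leLHS]mulr_natl ler_pM2l// ler_piMl ?cos_le1//.
exact: sin_ge0_pi.
Qed.

End UnitCircle.
Arguments unit_root {R}.

(** * The Cauchy formula in the mean over roots of unity *)

Section MeanValue.
Variable R : realType.
Local Notation C := (Cplx R).
Local Notation RtoC := (RtoC R).

Lemma avg_norm_le n (h : C -> C) (A : C) :
  (forall k, `|h (unit_root n k)| <= A) -> `|avg n h| <= A.
Proof.
move=> hA; rewrite /avg normrM normfV normrX normr_nat.
rewrite mulrC ler_pdivrMr ?exprn_gt0//; apply: le_trans (ler_norm_sum _ _ _) _.
apply: le_trans (ler_sum _ (fun k _ => hA k)) _.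
by rewrite big_const_nat subn0 iter_addr addr0 -[A *+ _]mulr_natr natrX.
Qed.

Lemma unit_rootE n k : unit_root n k = cis (pi *+ 2 * node R n k). Proof. by []. Qed.

Lemma sum_unit_root_shift n (q : C -> C) :
  \sum_(0 <= k < 2 ^ n) q (unit_root n k.+1) = \sum_(0 <= k < 2 ^ n) q (unit_root n k).
Proof.
apply: (addrI (q (unit_root n 0))).
rewrite -(big_nat_recl (2 ^ n) 0 (fun k => q (unit_root n k)))// big_nat_recr//= addrC.
congr (_ + _); congr q.
by rewrite !unit_rootE node_top mulr1 cis2pi /node mul0r mulr0 cis0.
Qed.

Lemma disc_neq_circle (x z : C) : `|x| < 1 -> `|z| = 1 -> z - x != 0.
Proof.
move=> x1 z1; rewrite subr_eq0; apply/eqP => zx.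
by move: x1; rewrite -zx z1 ltxx.
Qed.

(** For the integrand [H z / (z - x)] on the unit circle shrunk by the factor [s]
    towards [x], the factor [s] cancels between the denominator and the edge
    vector. Collecting the two edges that meet at each vertex of the closed polygon
    then turns the trapezoid sum into a plain sum over the roots of unity, with
    the common weight [(w - w^-1) / 2] where [w] is [unit_root n 1]. *)
Lemma trapezoid_circle (H : C -> C) (x s : C) n : `|x| < 1 -> s != 0 ->
  trapezoid (fun z => H z / (z - x)) n (fun t => x + s * (cis (pi *+ 2 * t) - x)) =
  'i * RtoC (sin (pi *+ 2 * node R n 1)) *
    \sum_(0 <= k < 2 ^ n)
      (H (x + s * (unit_root n k - x)) * (unit_root n k / (unit_root n k - x))).
Proof.
move=> x1 s0; pose q z := H (x + s * (z - x)) * (z / (z - x)).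
pose w := unit_root n 1 : C.
have w0 : w != 0 := cis_neq0 _.
have wV : w - w^-1 = 2 * ('i * RtoC (sin (pi *+ 2 * node R n 1))).
  by rewrite /w unit_rootE cisV /cis cosN sinN rmorphN/=; ring.
have -> : 'i * RtoC (sin (pi *+ 2 * node R n 1)) = (w - w^-1) / 2.
  by rewrite wV [RHS]mulrC mulKf ?pnatr_eq0.
transitivity (\sum_(0 <= k < 2 ^ n)
    ((w - 1) / 2 * q (unit_root n k) + (1 - w^-1) / 2 * q (unit_root n k.+1))).
  apply: eq_bigr => k _; rewrite -!unit_rootE.
  have u0 : unit_root n k - x != 0 by rewrite disc_neq_circle ?norm_unit_root.
  have v0 : unit_root n k * w - x != 0 by rewrite -unit_rootS disc_neq_circle ?norm_unit_root.
  have pK v : x + s * (v - x) - x = s * (v - x) by ring.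
  rewrite /q unit_rootS -/w !pK.
  set Hu := H _; set Hv := H _; by field; rewrite w0 u0 v0 s0.
rewrite big_split -!mulr_sumr /= (sum_unit_root_shift _ q) -mulrDl; congr (_ * _).
by field.
Qed.

Lemma circle_kernel_bound (x z : C) : `|x| < 1 -> `|z| = 1 ->
  `|z / (z - x)| <= (1 - `|x|)^-1.
Proof.
move=> x1 z1; rewrite normrM z1 mul1r normfV lef_pV2 ?posrE.
- by rewrite -z1 lerB_dist.
- by rewrite normr_gt0 disc_neq_circle.
- by rewrite subr_gt0.
Qed.

Lemma segment_lipschitz (x : C) (d : R) : `|x| < 1 -> 0 <= d <= 1 ->
  unit_square_lipschitz
    (fun s t => x + RtoC (d + (1 - d) * s) * (cis (pi *+ 2 * t) - x))
    (2 * (pi *+ 2)).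
Proof.
move=> x1 /andP[d0 d1] s t s' t' /andP[s0 s1] /andP[t0 t1] /andP[s'0 s'1] /andP[t'0 t'1].
have -> : x + RtoC (d + (1 - d) * s) * (cis (pi *+ 2 * t) - x) -
    (x + RtoC (d + (1 - d) * s') * (cis (pi *+ 2 * t') - x)) =
    RtoC ((1 - d) * (s - s')) * (cis (pi *+ 2 * t) - x) +
    RtoC (d + (1 - d) * s') * (cis (pi *+ 2 * t) - cis (pi *+ 2 * t')).
  by rewrite !(rmorphD, rmorphM, rmorphN, rmorphB)/=; ring.
have pi2 : 1 <= pi *+ 2 :> R by have := pi_ge2 R; rewrite mulr2n; lra.
apply: le_trans (ler_normD _ _) _; rewrite !normrM !normr_RtoC.
rewrite [X in _ <= RtoC X]mulrDr [leRHS]rmorphD.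
apply: lerD.
  have -> : 2 * (pi *+ 2) * `|s - s'| = pi *+ 2 * `|s - s'| * 2 by ring.
  rewrite [leRHS]rmorphM; apply: ler_pM => //; first by rewrite RtoC_ge0.
    rewrite ler_RtoC normrM ler_wpM2r// ger0_norm ?subr_ge0//; lra.
  apply: le_trans (ler_normB _ _) _; rewrite norm_cis rmorph_nat mulr2n lerD2l.
  exact: ltW.
apply: le_trans (_ : 1 * RtoC (2 * `|pi *+ 2 * t - pi *+ 2 * t'|) <= _).
  apply: ler_pM => //; last exact: cis_lipschitz.
    by rewrite RtoC_ge0.
  by rewrite -(rmorph1 RtoC) ler_RtoC ger0_norm; nra.
rewrite mul1r -mulrBr normrM [`|pi *+ 2|]ger0_norm ?mulrA//; lra.
Qed.

(** Cauchy's formula, in the form: the mean of [G z - G x] against [z / (z - x)]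
    tends to [0]. The unit circle is contracted towards [x] until [G] is almost
    [G x] on it; the contraction sweeps a region on which
    [(G z - G x) / (z - x)] is differentiable, so by [loop_cvg0] it changes the
    mean by a quantity tending to [0]. *)
Lemma avg_divided_difference_cvg0 (G : C -> C) (x : C) : `|x| < 1 ->
  (forall z, `|z| <= 1 -> differentiable G z) ->
  (avg n (fun z => (G z - G x) * (z / (z - x))) @[n --> \oo] --> (0 : C))%classic.
Proof.
move=> x1 dG; apply/cvgr0Pnorm_le => e0 e0gt.
have [e eE] := real_RtoC (gtr0_real e0gt); rewrite {}eE RtoC_gt0 in e0gt *.
have [rx rxE] := real_RtoC (normr_real x).
have rx1 : rx < 1 by rewrite -ltr_RtoC -rxE rmorph1.
have rx0 : 0 <= rx by rewrite -RtoC_ge0 -rxE.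
have [d d0 Gd] : exists2 d : R, 0 < d & forall w, `|w - x| < RtoC d ->
    `|G w - G x| <= RtoC (e / 2 * (1 - rx)).
  have e'0 : 0 < e / 2 * (1 - rx) by rewrite mulr_gt0 ?subr_gt0// divr_gt0.
  have /differentiable_continuous/cvgrPdist_le := dG x (ltW x1).
  move=> /(_ (RtoC (e / 2 * (1 - rx)))); rewrite RtoC_gt0 => /(_ e'0).
  move=> /nbhs_ballP[d /= d0 H].
  have [r dr] := real_RtoC (gtr0_real d0); exists r.
    by rewrite -RtoC_gt0 -dr.
  by move=> w wr; rewrite distrC; apply: H; rewrite -ball_normE/= distrC dr.
(* The contraction stops at the ratio [s0], where the circle is inside the ball
   of radius [d] around [x]: its points are within [2 * s0 < d] of [x]. *)
pose s0 : R := d / (d + 2).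
have s0gt : 0 < s0 by rewrite divr_gt0 ?addr_gt0.
have s0lt : s0 < 1 by rewrite ltr_pdivrMr ?addr_gt0//; lra.
have s0d : 2 * s0 < d.
  by rewrite /s0 mulrA ltr_pdivrMr ?addr_gt0//; nra.
pose g z := (G z - G x) / (z - x).
pose phi s t := x + RtoC (s0 + (1 - s0) * s) * (cis (pi *+ 2 * t) - x).
have dg s t : 0 <= s <= 1 -> 0 <= t <= 1 -> differentiable g (phi s t).
  move=> /andP[s0' s1] _.
  pose r : R := s0 + (1 - s0) * s.
  have r0 : 0 < r by rewrite /r; nra.
  have r1 : r <= 1 by rewrite /r; nra.
  have pE : phi s t = RtoC (1 - r) * x + RtoC r * cis (pi *+ 2 * t).
    by rewrite /phi -/r rmorphB rmorph1; ring.
  have px : phi s t - x != 0.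
    rewrite /phi addrAC subrr add0r mulf_neq0 ?disc_neq_circle ?norm_cis//.
    by rewrite gt_eqF// RtoC_gt0.
  have p1 : `|phi s t| <= 1.
    rewrite pE; apply: le_trans (ler_normD _ _) _.
    rewrite !normrM !normr_RtoC norm_cis mulr1 rxE -rmorphM -rmorphD.
    rewrite -(rmorph1 RtoC) ler_RtoC !ger0_norm ?subr_ge0//; last exact: ltW.
    nra.
  apply: (@differentiableM _ _ (fun z => G z - G x) (fun z => (z - x)^-1)).
    by apply: differentiableB => //; exact: dG.
  by apply: (@differentiableV _ _ (fun z : C => z - x)).
have L0 : 0 < 2 * (pi *+ 2) :> R.
  by rewrite mulr_gt0// pmulrn_lgt0// pi_gt0.
have phiL : unit_square_lipschitz phi (2 * (pi *+ 2)).
  by apply: segment_lipschitz => //; rewrite !ltW.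
have [N loopN] := loop_cvg0 phiL L0 dg e0gt.
exists (maxn 2 N) => // n /=; rewrite geq_max => /andP[n2 nN].
pose q (s z : C) := (G (x + s * (z - x)) - G x) * (z / (z - x)).
have -> : (fun z => (G z - G x) * (z / (z - x))) = q 1.
  by apply/funext => z; rewrite /q mul1r [x + _]addrC subrK.
have sums : loop g phi n 0 0 1 = 'i * RtoC (sin (pi *+ 2 * node R n 1)) *
    (\sum_(0 <= k < 2 ^ n) q 1 (unit_root n k) -
     \sum_(0 <= k < 2 ^ n) q (RtoC s0) (unit_root n k)).
  have s0C : RtoC s0 != 0 by rewrite gt_eqF// RtoC_gt0.
  rewrite mulrBr.
  rewrite -(@trapezoid_circle (fun z => G z - G x) x 1 n x1 (oner_neq0 _)).
  rewrite -(@trapezoid_circle (fun z => G z - G x) x (RtoC s0) n x1 s0C).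
  have E c1 c2 : c1 =1 c2 -> trapezoid g n c1 = trapezoid g n c2.
    by move=> /funext->.
  rewrite /loop.
  rewrite (E (fun t => phi (0 + 1 * t) 0) (fun t => phi t 0)); last first.
    by move=> t; rewrite add0r mul1r.
  rewrite (E (fun t => phi (0 + 1 * t) (0 + 1)) (fun t => phi t 0)); last first.
    by move=> t; rewrite !add0r mul1r /phi mulr1 mulr0 cis2pi cis0.
  (* The sides [t = 0] and [t = 1] of the square have the same image, since
     the parametrization is periodic in [t]. *)
  have sides (a b c : C) : a + b - a - c = b - c by ring.
  rewrite sides; congr (_ - _); apply: E => t.
    by rewrite /phi !add0r mul1r mulr1 addrCA subrr addr0 rmorph1.
  by rewrite /phi add0r mul1r mulr0 addr0.
have sn : 4 <= 2 ^+ n * sin (pi *+ 2 * node R n 1) :> R := sin_unit_root_ge R n2.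
set sn1 := sin _ in sn sums.
have sn0 : 0 < sn1.
  by rewrite -(@pmulr_rgt0 _ (2 ^+ n)) ?exprn_gt0//; lra.
have iN0 : 'i * RtoC sn1 != 0 :> C.
  by rewrite mulf_neq0 ?neq0Ci// gt_eqF// RtoC_gt0.
have avgE : avg n (q 1) =
    avg n (q (RtoC s0)) + loop g phi n 0 0 1 / (2 ^+ n * ('i * RtoC sn1)).
  rewrite sums /avg; set S1 := \sum_(_ <= _ < _) _; set S2 := \sum_(_ <= _ < _) _.
  field; rewrite neq0Ci gt_eqF ?RtoC_gt0// expf_neq0// pnatr_eq0.
rewrite avgE; apply: le_trans (ler_normD _ _) _.
have -> : e = e / 2 + e / 2 by field.
rewrite rmorphD; apply: lerD.
  apply: avg_norm_le => k; rewrite /q normrM.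
  have -> : RtoC (e / 2) = RtoC (e / 2 * (1 - rx)) * (1 - `|x|)^-1.
    rewrite rxE -(rmorph1 RtoC) -rmorphB -fmorphV -rmorphM; congr (RtoC _).
    by rewrite mulfK// gt_eqF// subr_gt0.
  apply: ler_pM => //; last exact: circle_kernel_bound (norm_unit_root _ _ _).
  apply: Gd; rewrite addrAC subrr add0r normrM normr_RtoC.
  rewrite [`|s0|]gtr0_norm//.
  apply: le_lt_trans (_ : _ <= RtoC (2 * s0)) _; last by rewrite ltr_RtoC.
  rewrite [leLHS]mulrC [leRHS]rmorphM ler_pM2r ?RtoC_gt0//.
  apply: le_trans (ler_normB _ _) _; rewrite norm_unit_root rmorph_nat mulr2n lerD2l.
  exact: ltW.
rewrite normrM normfV !normrM normCi mul1r normr_RtoC [`|sn1|]gtr0_norm//.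
have -> : `|2 ^+ n : C| = RtoC (2 ^+ n) by rewrite normrX normr_nat rmorphXn rmorph_nat.
rewrite -rmorphM.
rewrite ler_pdivrMr ?RtoC_gt0 ?mulr_gt0 ?exprn_gt0// -rmorphM.
apply: le_trans (loopN _ nN) _; rewrite ler_RtoC; nra.
Qed.

End MeanValue.

(** * Positivity of the Pick matrix *)

Section Pick.
Variable R : realType.
Local Notation C := (Cplx R).
Local Notation RtoC := (RtoC R).

(** The Szego kernel, reproducing kernel of the Hardy space of the disc. *)
Definition szego (y z : C) : C := (1 - y^* * z)^-1.

Lemma szego_den_neq0 (y z : C) : `|y| < 1 -> `|z| <= 1 -> 1 - y^* * z != 0.
Proof.
move=> y1 z1; rewrite subr_eq0; apply/eqP => /(congr1 Num.norm).
rewrite normr1 normrM norm_conjC => yz.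
have : `|y| * `|z| <= `|y| by rewrite ler_piMr.
by rewrite -yz (lt_geF y1).
Qed.

Lemma differentiable_szego (y z : C) : `|y| < 1 -> `|z| <= 1 ->
  differentiable (szego y) z.
Proof.
move=> y1 z1; apply: (@differentiableV _ _ (fun z => 1 - y^* * z)).
  exact: differentiableB.
exact: szego_den_neq0.
Qed.

Lemma eq_avg n (h1 h2 : C -> C) : (forall z, `|z| = 1 -> h1 z = h2 z) ->
  avg n h1 = avg n h2.
Proof.
by move=> h12; rewrite /avg; congr (_ * _); apply: eq_bigr => k _;
  rewrite h12// norm_unit_root.
Qed.

Lemma avgD n (h1 h2 : C -> C) : avg n (fun z => h1 z + h2 z) = avg n h1 + avg n h2.
Proof. by rewrite /avg big_split/= mulrDr. Qed.

Lemma avgB n (h1 h2 : C -> C) : avg n (fun z => h1 z - h2 z) = avg n h1 - avg n h2.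
Proof. by rewrite /avg sumrB/= mulrBr. Qed.

Lemma avgZ n a (h : C -> C) : avg n (fun z => a * h z) = a * avg n h.
Proof. by rewrite /avg -mulr_sumr mulrCA. Qed.

Lemma avg_sum n m (h : 'I_m -> C -> C) :
  avg n (fun z => \sum_i h i z) = \sum_i avg n (h i).
Proof. by rewrite /avg exchange_big/= mulr_sumr. Qed.

Lemma avg_conj n (h : C -> C) : avg n (fun z => (h z)^*) = (avg n h)^*.
Proof.
by rewrite /avg rmorphM fmorphV rmorphXn rmorph_nat rmorph_sum.
Qed.

Lemma avg_ge0 n (h : C -> C) : (forall z, `|z| = 1 -> 0 <= h z) -> 0 <= avg n h.
Proof.
move=> h0; rewrite mulr_ge0 ?invr_ge0 ?exprn_ge0//.
by apply: sumr_ge0 => k _; rewrite h0 ?norm_unit_root.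
Qed.

Lemma avg1 n : avg n (fun=> 1) = 1 :> C.
Proof.
by rewrite /avg big_const_nat subn0 iter_addr addr0 natrX mulVf// expf_neq0 ?pnatr_eq0.
Qed.

Lemma conj_szego (x z : C) : `|z| = 1 -> (szego x z)^* = z / (z - x).
Proof.
move=> z1; have z0 : z != 0 by rewrite -normr_gt0 z1.
rewrite /szego fmorphV rmorphB rmorphM rmorph1 /= conjCK.
have -> : z^* = z^-1 by rewrite invC_norm z1 expr1n invr1 mul1r.
by rewrite -[1](divff z0) -mulrBl invfM invrK mulrC.
Qed.

(** The reproducing property. On the circle, [(szego x z)^*] is
    [z / (z - x)]; the divided difference formula at [x] reduces the claim to the
    case of a constant [G], which is the conjugate of the mean value property of
    [szego x] at [0]. *)
Lemma avg_szego_cvg (G : C -> C) (x : C) : `|x| < 1 ->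
  (forall z, `|z| <= 1 -> differentiable G z) ->
  (avg n (fun z => G z * (szego x z)^*) @[n --> \oo] --> G x)%classic.
Proof.
move=> x1 dG.
have s1 : (avg n (szego x) @[n --> \oo] --> (1 : C))%classic.
  have E n : avg n (szego x) =
      1 + avg n (fun z => (szego x z - szego x 0) * (z / (z - 0))).
    rewrite -{1}(avg1 n) -avgD; apply: eq_avg => z z1.
    rewrite subr0 divff -?normr_gt0 ?z1// mulr1 {3}/szego mulr0 subr0 invr1.
    by rewrite subrKC.
  rewrite (funext E) -[X in (_ --> X)%classic]addr0.
  apply: cvgD; first exact: cvg_cst.
  apply: avg_divided_difference_cvg0; first by rewrite normr0.
  by move=> z z1; exact: differentiable_szego.
have E n : avg n (fun z => G z * (szego x z)^*) =
    avg n (fun z => (G z - G x) * (z / (z - x))) + G x * (avg n (szego x))^*.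
  rewrite -avg_conj -avgZ -avgD; apply: eq_avg => z z1.
  by rewrite conj_szego//; ring.
rewrite (funext E) -[X in (_ --> X)%classic]add0r -[X in 0 + X]mulr1.
apply: cvgD; first exact: avg_divided_difference_cvg0.
by apply: cvgM; [exact: cvg_cst | rewrite -(rmorph1 Num.conj); exact: cvg_conj].
Qed.

Definition szego_comb m (x a : 'I_m -> C) (z : C) := \sum_j a j * szego (x j) z.

Lemma avg_szego_comb_cvg m (x a : 'I_m -> C) (G : C -> C) :
  (forall i, `|x i| < 1) -> (forall z, `|z| <= 1 -> differentiable G z) ->
  (avg n (fun z => G z * (szego_comb x a z)^*) @[n --> \oo] -->
     \sum_i (a i)^* * G (x i))%classic.
Proof.
move=> x1 dG.
have E n : avg n (fun z => G z * (szego_comb x a z)^*) =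
    \sum_i (a i)^* * avg n (fun z => G z * (szego (x i) z)^*).
  have -> : \sum_i (a i)^* * avg n (fun z => G z * (szego (x i) z)^*) =
      \sum_i avg n (fun z => (a i)^* * (G z * (szego (x i) z)^*)).
    by apply: eq_bigr => i _; exact/esym/avgZ.
  rewrite -avg_sum; apply: eq_avg => z _; rewrite /szego_comb rmorph_sum mulr_sumr.
  by apply: eq_bigr => i _; rewrite rmorphM mulrCA.
rewrite (funext E); apply: cvg_sum => i.
by apply: cvgM; [exact: cvg_cst | exact: avg_szego_cvg].
Qed.

Lemma differentiable_szego_comb m (x a : 'I_m -> C) (z : C) :
  (forall i, `|x i| < 1) -> `|z| <= 1 -> differentiable (szego_comb x a) z.
Proof.
move=> x1 z1.
have -> : szego_comb x a = \sum_j (fun z => a j * szego (x j) z).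
  by apply/funext => w; rewrite /szego_comb fct_sumE.
apply: differentiable_sum => j.
apply: (@differentiableM _ _ (fun=> a j) (szego (x j))) => //.
exact: differentiable_szego.
Qed.

(** In Hardy space terms, let [h] be the combination of the Szego kernels at the
    [x j] with coefficients [c j], and [u] the one with coefficients
    [c j * (f (x j))^*], that is, the image of [h] under the adjoint of
    multiplication by [f]. The quadratic form is the squared norm of [h] minus that
    of [u], and, because the inner product of [f u] with [h] is the squared norm
    of [u], it is also the limit of the means of
    [|h - f u|^2 + (1 - |f|^2) |u|^2]. *)
Lemma pick_matrix_ge0_closed (f : C -> C) m (x c : 'I_m -> C) :
  (forall z, `|z| <= 1 -> differentiable f z) ->
  (forall z, `|z| <= 1 -> `|f z| <= 1) ->
  (forall i, `|x i| < 1) ->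
  0 <= \sum_i \sum_j (c i)^* * c j *
    ((1 - (f (x j))^* * f (x i)) / (1 - (x j)^* * x i)).
Proof.
move=> df f1 x1.
pose h := szego_comb x c.
pose u := szego_comb x (fun j => c j * (f (x j))^*).
have dh z : `|z| <= 1 -> differentiable h z by move=> z1; exact: differentiable_szego_comb.
have du z : `|z| <= 1 -> differentiable u z by move=> z1; exact: differentiable_szego_comb.
have dfu z : `|z| <= 1 -> differentiable (fun z => f z * u z) z.
  by move=> z1; apply: differentiableM; [exact: df | exact: du].
pose S1 := \sum_i (c i)^* * h (x i).
pose S2 := \sum_i (c i)^* * (f (x i) * u (x i)).
have cvh := avg_szego_comb_cvg (a := c) x1 dh; rewrite -/S1 -/h in cvh.
have cvfu := avg_szego_comb_cvg (a := c) x1 dfu; rewrite -/S2 -/h in cvfu.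
have cvu := avg_szego_comb_cvg (a := fun j => c j * (f (x j))^*) x1 du; rewrite -/u in cvu.
have S2E : \sum_i (c i * (f (x i))^*)^* * u (x i) = S2.
  by apply: eq_bigr => i _; rewrite rmorphM /= conjCK mulrA.
rewrite S2E in cvu.
have S2r : S2^* = S2.
  apply: conj_Creal; apply: ger0_real; apply: cvg_ge0 cvu => n.
  by apply: avg_ge0 => z _; rewrite mul_conjC_ge0.
have : 0 <= S1 - S2.
  have -> : S1 - S2 = S1 + S2 - S2 - S2^* by rewrite S2r; ring.
  apply: cvg_ge0 (cvgB (cvgB (cvgD cvh cvu) cvfu) (cvg_conj cvfu)) => n /=.
  rewrite !fctE/= -avg_conj -avgD -!avgB; apply: avg_ge0 => z z1.
  have -> : h z * (h z)^* + u z * (u z)^* - f z * u z * (h z)^* -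
      (f z * u z * (h z)^*)^* =
      (h z - f z * u z) * (h z - f z * u z)^* +
      (1 - f z * (f z)^*) * (u z * (u z)^*).
    by rewrite !(rmorphB, rmorphM)/= conjCK; ring.
  rewrite addr_ge0 ?mul_conjC_ge0// mulr_ge0 ?mul_conjC_ge0//.
  by rewrite subr_ge0 -normCK exprn_ile1// f1// z1.
congr (0 <= _); rewrite /S1 /S2 -sumrB; apply: eq_bigr => i _.
rewrite -mulrBr /h /u /szego_comb [f _ * _]mulr_sumr -sumrB mulr_sumr.
by apply: eq_bigr => j _; rewrite /szego; ring.
Qed.

(** The functions [z |-> f (r z)] with [r < 1] satisfy the hypotheses on the closed
    disc, and their Pick matrices tend to that of [f]. *)
Theorem pick_matrix_ge0 (f : C -> C) m (x c : 'I_m -> C) :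
  (forall z, `|z| < 1 -> differentiable f z) ->
  (forall z, `|z| < 1 -> `|f z| <= 1) ->
  (forall i, `|x i| < 1) ->
  0 <= \sum_i \sum_j (c i)^* * c j *
    ((1 - (f (x j))^* * f (x i)) / (1 - (x j)^* * x i)).
Proof.
move=> df f1 x1.
pose r n : R := 1 - n.+1%:R^-1.
have rI n : 0 <= r n < 1.
  by rewrite /r subr_ge0 ltrBlDr ltrDl invr_gt0 ltr0n andbT invf_le1 ?ler1n.
have rn1 n : `|RtoC (r n)| < 1.
  have /andP[r0 r1] := rI n.
  by rewrite normr_RtoC ger0_norm// -(rmorph1 RtoC) ltr_RtoC.
have rz n (z : C) : `|z| <= 1 -> `|RtoC (r n) * z| < 1.
  move=> z1; rewrite normrM; apply: le_lt_trans (rn1 n).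
  by rewrite ler_piMr.
have rcvg (z : C) : (RtoC (r n) * z @[n --> \oo] --> z)%classic.
  rewrite -[X in (_ --> X)%classic]mul1r -(rmorph1 RtoC).
  apply: cvgM; last exact: cvg_cst.
  apply: cvg_RtoC; rewrite -[X in (_ --> X)%classic]subr0.
  by apply: cvgB; [exact: cvg_cst | exact: cvg_harmonic].
have fcvg i : (f (RtoC (r n) * x i) @[n --> \oo] --> f (x i))%classic.
  apply: (@continuous_cvg _ _ _ _ _ (fun n => RtoC (r n) * x i) f); last exact: rcvg.
  by apply: differentiable_continuous; exact: df.
pose S n := \sum_i \sum_j (c i)^* * c j *
  ((1 - (f (RtoC (r n) * x j))^* * f (RtoC (r n) * x i)) / (1 - (x j)^* * x i)).
have S0 n : 0 <= S n.
  pose g (z : C) := f (RtoC (r n) * z).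
  have dg z : `|z| <= 1 -> differentiable g z.
    move=> z1; apply: (@differentiable_comp _ _ _ _ (fun z => RtoC (r n) * z) f).
      by apply: (@differentiableM _ _ (fun=> RtoC (r n)) (fun z : C => z)).
    by apply: df; exact: rz.
  have g1 z : `|z| <= 1 -> `|g z| <= 1 by move=> z1; apply: f1; exact: rz.
  exact: (pick_matrix_ge0_closed c dg g1 x1).
apply: (cvg_ge0 S0).
apply: cvg_sum => i; apply: cvg_sum => j.
apply: cvgM; first exact: cvg_cst.
apply: cvgM; last exact: cvg_cst.
apply: cvgB; first exact: cvg_cst.
by apply: cvgM => //; exact: cvg_conj.
Qed.

End Pick.

(** * Entries of a matrix and its operator norm *)

Section OperatorNormEntries.
Variable R : realType.
Local Notation C := (Cplx R).
Local Notation RtoC := (RtoC R).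

Lemma l2norm_ge0 n (v : 'cV[C]_n) : 0 <= l2norm v.
Proof. exact: sqrtr_ge0. Qed.

Lemma sqr_l2norm n (v : 'cV[C]_n) : RtoC (l2norm v) ^+ 2 = \sum_i `|v i 0| ^+ 2.
Proof.
rewrite /l2norm -rmorphXn sqr_sqrtr; last first.
  by apply: sumr_ge0 => i _; rewrite addr_ge0 ?sqr_ge0.
by rewrite rmorph_sum; apply: eq_bigr => i _; exact: add_Re2_Im2.
Qed.

Lemma norm_le_l2norm n (v : 'cV[C]_n) i : `|v i 0| <= RtoC (l2norm v).
Proof.
rewrite -(@ler_pXn2r _ 2)// ?nnegrE ?RtoC_ge0 ?l2norm_ge0// sqr_l2norm.
rewrite (bigD1 i)//= lerDl.
by apply: sumr_ge0 => j _; rewrite exprn_ge0.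
Qed.

(** The entry is a coordinate of the image of a basis vector. The operator norm is
    a supremum in [R], hence informative only for a set bounded above: the
    bound is the Euclidean norm of the vector of absolute row sums. *)
Lemma norm_entry_le_opnorm m n (A : 'M[C]_(m, n)) i j :
  `|A i j| <= RtoC (opnorm A).
Proof.
set S := [set l2norm (A *m v) | v in [set v | l2norm v <= 1]]%classic.
have delta1 : l2norm (delta_mx j 0 : 'cV[C]_n) <= 1.
  rewrite -ler_RtoC rmorph1 -(@ler_pXn2r _ 2)// ?nnegrE ?RtoC_ge0 ?l2norm_ge0//.
  rewrite sqr_l2norm expr1n (bigD1 j)//= mxE !eqxx normr1 expr1n big1 ?addr0// => k kj.
  by rewrite mxE (negPf kj) normr0 expr0n.
pose B := \sum_k (\sum_l `|A k l|) ^+ 2.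
have B0 : 0 <= B.
  by apply: sumr_ge0 => k _; rewrite exprn_ge0// sumr_ge0.
have [b bE] := real_RtoC (ger0_real B0).
have b0 : 0 <= b by rewrite -RtoC_ge0 -bE.
have bounded : has_ubound S.
  exists (Num.sqrt b) => _ [v v1 <-].
  rewrite -(@ler_pXn2r _ 2)// ?nnegrE ?sqrtr_ge0 ?l2norm_ge0// (sqr_sqrtr b0).
  rewrite -ler_RtoC (rmorphXn RtoC) sqr_l2norm -bE; apply: ler_sum => k _.
  apply: lerXn2r; rewrite ?nnegrE// ?sumr_ge0// mxE.
  apply: le_trans (ler_norm_sum _ _ _) _; apply: ler_sum => l _.
  rewrite normrM ler_piMr//; apply: le_trans (norm_le_l2norm _ _) _.
  by rewrite -(rmorph1 RtoC) ler_RtoC.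
apply: (@le_trans _ _ (RtoC (l2norm (A *m delta_mx j 0)))).
  by apply: le_trans (norm_le_l2norm _ i); rewrite -colE mxE.
by rewrite ler_RtoC; apply: ub_le_sup => //; exists (delta_mx j 0).
Qed.

End OperatorNormEntries.

(** * Reproducing kernel Hilbert spaces of dimension 0 and 1 *)

Section RankOne.
Variables (R : realType) (X : Type).
Local Notation C := (Cplx R).
Local Notation RtoC := (RtoC R).

Lemma kernel_rank0 : kernel_rank (fun _ _ : X => 0 : C) 0.
Proof.
exists [set 0]%classic, (fun _ _ => 0); split; last first.
  exists (fun=> 0); split=> // [c _ []//|f ->].
  by exists (fun=> 0); rewrite big_ord0.
split=> //; last by move=> f y ->.
split=> //.
- by move=> a f g -> ->; rewrite scaler0 addr0.
- by move=> *; rewrite mulr0 addr0.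
- by move=> *; rewrite rmorph0.
- by move=> u u0 _; exists 0 => //; exact: cvg_cst.
Qed.

(** The space is the line spanned by [phi], normed so that [phi] is a unit vector.
    The coefficient of [f] on [phi] is read off at [x0], as [f x0 / phi x0]. *)
Lemma kernel_rank1 (phi : X -> C) (x0 : X) : phi x0 != 0 ->
  kernel_rank (fun x y => (phi y)^* * phi x) 1.
Proof.
move=> p0.
pose H : set (X -> C) := [set f | exists a : C, f = a *: phi]%classic.
pose dot (f g : X -> C) : C := f x0 / phi x0 * (g x0 / phi x0)^*.
have dotE (a b : C) : dot (a *: phi) (b *: phi) = a * b^*.
  by rewrite /dot /= !fctE /= /GRing.scale /= !mulfK.
exists H, dot; split; last first.
  exists (fun=> phi); split=> [_|c|f [a ->]].
  - by exists 1; rewrite scale1r.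
  - rewrite big_ord1 => /(congr1 (fun f => f x0)) /eqP.
    rewrite !fctE /GRing.scale /= mulf_eq0 (negPf p0) orbF => /eqP c0 i.
    by rewrite (ord1 i).
  - by exists (fun=> a); rewrite big_ord1.
split; last 2 first.
- by move=> y; exists (phi y)^*.
- move=> f y [a ->].
  have -> : (fun x => (phi y)^* * phi x) = (phi y)^* *: phi by [].
  by rewrite dotE conjCK.
split.
- by exists 0; rewrite scale0r.
- by move=> a f g [b ->] [c ->]; exists (a * b + c); rewrite scalerDl scalerA.
- move=> a f g h [b ->] [c ->] [d ->].
  by rewrite scalerA -scalerDl !dotE; ring.
- by move=> f g [b ->] [c ->]; rewrite !dotE rmorphM/= conjCK mulrC.
- move=> f [b ->] bphi; rewrite dotE mul_conjC_gt0.
  by apply: contra_notN bphi => /eqP->; rewrite scale0r.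
- move=> u uH cauchy_u.
  have [a aE] := choice uH.
  have dotB m n : dot (u m - u n) (u m - u n) = `|a m - a n| ^+ 2.
    by rewrite !aE -scalerBl dotE normCK.
  have [l al] : exists l : C, (a n @[n --> \oo] --> l)%classic.
    apply: Cplx_cauchy_cvg => e e0.
    have [N hN] := cauchy_u (e ^+ 2) (exprn_gt0 _ e0).
    exists N => m n Nm Nn; have := hN m n Nm Nn.
    by rewrite dotB ltr_pXn2r ?nnegrE// ltW.
  exists (l *: phi); first by exists l.
  have E n : dot (u n - l *: phi) (u n - l *: phi) = `|a n - l| * `|a n - l|.
    by rewrite !aE -scalerBl dotE -normCK expr2.
  rewrite (funext E) -[X in (_ --> X)%classic](mulr0 0).
  have al0 : (`|a n - l| @[n --> \oo] --> (0 : C))%classic.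
    rewrite -[X in (_ --> X)%classic](@normr0 _ C) -(subrr l).
    by apply: cvg_norm; apply: cvgB => //; exact: cvg_cst.
  exact: cvgM.
Qed.

End RankOne.

(** * Kernels depending only on the disc variables *)

Section DiscKernels.
Variable R : realType.
Local Notation C := (Cplx R).

(** The formulas for the kernels hold on the tridisc only, which is open: they
    determine the derivatives there because differentiability is local. *)
Lemma near_eq_differentiable (V W : normedModType C) (f g : V -> W) (x : V) :
  (\forall y \near x, f y = g y)%classic -> differentiable f x -> differentiable g x.
Proof.
move=> fg df.
have gx : g \o shift x = cst (g x) + 'd f x +o_ 0 id.
  apply/eqaddoP => e e0; have /eqaddoP/(_ e e0) := diff_locally df.
  have fg0 : (\forall h \near (0 : V), f (h + x) = g (h + x))%classic.
    by move: fg; rewrite (near_shift 0 x) /=; apply: filterS => h /=; rewrite subr0.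
  apply: filterS2 fg0 => h; rewrite !fctE /= => ->.
  by rewrite (nbhs_singleton fg).
have dc : continuous ('d f x) by exact: diff_continuous.
by apply/diff_locallyP; rewrite (diff_unique dc gx).
Qed.

Lemma open_disc : open (@disc R).
Proof.
have -> : @disc R = ball (0 : C) 1.
  by rewrite -ball_normE; apply/seteqP; split=> l /=; rewrite /disc /= sub0r normrN.
exact: ball_open.
Qed.

Lemma near_tridisc (p : C * (C * C)) : tridisc p ->
  (\forall q \near p, tridisc q)%classic.
Proof.
case: p => l [z1 z2] [/= dl [/= d1 d2]].
have nd y : disc y -> nbhs y (@disc R).
  by move=> dy; apply: open_nbhs_nbhs; split => //; exact: open_disc.
exists (@disc R, @bidisc R); first split => /=.
- exact: nd.
- by exists (@disc R, @disc R); [split; exact: nd | case].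
- by case.
Qed.

(** Hermitian symmetry reduces conjugate analyticity in the second point to
    analyticity in the first. *)
Lemma analytic_kernel_of_disc (k : C -> C -> C) (N : kernelD3 R) :
  (forall p q, tridisc p -> tridisc q -> N p q = k p.1 q.1) ->
  (forall l m, disc l -> disc m -> k m l = (k l m)^*) ->
  (forall l m, disc l -> disc m -> differentiable (k ^~ m) l) ->
  (forall n (x c : 'I_n -> C), (forall i, disc (x i)) ->
    0 <= \sum_i \sum_j (c i)^* * c j * k (x i) (x j)) ->
  analytic_kernel N.
Proof.
move=> Nk herm dk psd.
have dfst q p : tridisc p -> tridisc q ->
    differentiable (fun p : C * (C * C) => k p.1 q.1) p.
  move=> [p1 _] [q1 _].
  apply: (@differentiable_comp _ _ _ _ fst (k ^~ q.1)).
    apply: (@linear_differentiable _ _ _ (fst : {linear (C * (C * C))%type -> C})).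
    by move=> r; exact: cvg_fst.
  exact: dk.
split.
- move=> n x c; have := psd n (fun i => (\val (x i)).1) c.
  move=> /(_ (fun i => proj1 (set_valP (x i)))); congr (_ <= _).
  apply: eq_bigr => i _; apply: eq_bigr => j _; congr (_ * _).
  by rewrite /on_tridisc Nk//; exact: set_valP.
- move=> q dq p dp; apply: near_eq_differentiable (dfst q p dp dq).
  by apply: filterS (near_tridisc dp) => p' dp'; rewrite Nk.
- move=> p dp q dq; apply: near_eq_differentiable (dfst p q dq dp).
  apply: filterS (near_tridisc dq) => q' dq'; rewrite Nk//.
  by apply: herm; [case: dp | case: dq'].
Qed.

End DiscKernels.

(** * The kernels of a Schur function with vanishing lower left block *)

Section TriangularSchur.
Local Open Scope sesquilinear_scope.
Variables (R : realType) (F : Cplx R -> 'M[Cplx R]_3).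
Local Notation C := (Cplx R).
Local Notation RtoC := (RtoC R).
Hypothesis hF : schur_class F.
Hypothesis hF0 : forall l, disc l -> dlsubmx (Fblk F l) = 0.

Lemma F11_differentiable l : disc l -> differentiable (F11 F) l.
Proof.
move=> dl; apply: (@differentiable_comp _ _ _ _ F (fun A : 'M[C]_3 => A 0 0)).
  exact: hF.1.
exact: differentiable_coord.
Qed.

Lemma F11_le1 l : disc l -> `|F11 F l| <= 1.
Proof.
move=> dl; apply: le_trans (norm_entry_le_opnorm _ _ _) _.
by rewrite -(rmorph1 RtoC) ler_RtoC; exact: hF.2.
Qed.

Lemma F_column1 l : disc l -> F l 1 0 = 0 /\ F l 2 0 = 0.
Proof.
move=> dl; have /matrixP F0 := hF0 dl.
split; [have := F0 0 0 | have := F0 1 0]; rewrite !mxE /Fblk => <-;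
  by congr (F l _ _); exact: val_inj.
Qed.

Lemma gammaF_eq0 l z : disc l -> gammaF F l z = 0.
Proof. by move=> dl; rewrite /gammaF hF0// mulmx0. Qed.

Lemma NF1_eq0 l m z w : disc l -> NF1 F (l, z) (m, w) = 0.
Proof. by move=> dl; rewrite /NF1 /gamma1 /= (gammaF_eq0 z dl) [X in _ * X]mxE mulr0. Qed.

Lemma NF2_eq0 l m z w : disc l -> NF2 F (l, z) (m, w) = 0.
Proof. by move=> dl; rewrite /NF2 /gamma2 /= (gammaF_eq0 z dl) [X in _ * X]mxE mulr0. Qed.

(** With this value the third kernel only sees the first column of [F], whose
    lower entries vanish by [F_column1]. *)
Lemma etaF_delta l z : disc l -> etaF F l z = delta_mx 0 0.
Proof.
move=> dl; apply/matrixP => i j; rewrite (ord1 j) !mxE /gamma1 /gamma2.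
rewrite (gammaF_eq0 z dl) !mxE !mulr0.
by case: i => [[|[|[|//]]] ?].
Qed.

Lemma NF3E l m z w : disc l -> disc m ->
  NF3 F (l, z) (m, w) = (1 - (F11 F m)^* * F11 F l) / (1 - m^* * l).
Proof.
move=> dl dm; rewrite /NF3 /= !etaF_delta//.
have [l1 l2] := F_column1 dl.
have -> : (delta_mx 0 0 : 'cV[C]_3) ^t* = delta_mx 0 0.
  by apply/matrixP => i j; rewrite !mxE rmorph_nat andbC.
rewrite -rowE -colE !mxE !big_ord_recl big_ord0 !mxE.
rewrite [RHS]mulrC; congr (_ * (_ - _)).
have -> : lift ord0 ord0 = 1 :> 'I_3 by exact: val_inj.
have -> : lift ord0 (lift ord0 ord0) = 2 :> 'I_3 by exact: val_inj.
by rewrite l1 l2 !mulr0 !addr0.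
Qed.

Lemma KofE l m z w : disc l -> disc m ->
  Kof (NF1 F) (NF2 F) (NF3 F) (l, z) (m, w) = (F11 F m)^* * F11 F l.
Proof.
move=> dl dm; case: z => z1 z2; case: w => w1 w2.
rewrite /Kof NF1_eq0// NF2_eq0// NF3E// !mulr0 !subr0 mulrC divfK ?subKr//.
exact: szego_den_neq0 (ltW dl).
Qed.

End TriangularSchur.

Theorem proposition3p3 (R : realType) (F : Cplx R -> 'M[Cplx R]_3)
    (hF : schur_class F)
    (hF0 : forall l, disc l -> dlsubmx (Fblk F l) = 0) :
  [/\ [/\ analytic_kernel (NF1 F), analytic_kernel (NF2 F)
        & analytic_kernel (NF3 F)],
      rankD3 (NF1 F) 0 /\ rankD3 (NF2 F) 0,
      analytic_kernel (Kof (NF1 F) (NF2 F) (NF3 F)) /\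
      ((exists2 l, disc l & F11 F l <> 0) ->
         R1tilde (NF1 F, NF2 F, NF3 F)) &
      forall (l m : Cplx R) (z w : Cplx R * Cplx R),
        disc l -> disc m -> bidisc z -> bidisc w ->
        [/\ NF1 F (l, z) (m, w) = 0,
            NF2 F (l, z) (m, w) = 0,
            NF3 F (l, z) (m, w) =
              (1 - (F11 F m)^* * F11 F l) / (1 - m^* * l) &
            Kof (NF1 F) (NF2 F) (NF3 F) (l, z) (m, w) =
              (F11 F m)^* * F11 F l]].
Proof.
have f_diff l : disc l -> differentiable (F11 F) l by exact: F11_differentiable.
have k_psd n (x c : 'I_n -> Cplx R) : (forall i, disc (x i)) ->
    0 <= \sum_i \sum_j (c i)^* * c j * ((F11 F (x j))^* * F11 F (x i)).
  move=> _; pose s := \sum_i (c i)^* * F11 F (x i).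
  have -> : \sum_i \sum_j (c i)^* * c j * ((F11 F (x j))^* * F11 F (x i)) = s * s^*.
    rewrite /s rmorph_sum mulr_suml; apply: eq_bigr => i _.
    by rewrite mulr_sumr; apply: eq_bigr => j _; rewrite rmorphM/= conjCK; ring.
  exact: mul_conjC_ge0.
have zero_kernel (N : kernelD3 R) :
    (forall l m z w, disc l -> N (l, z) (m, w) = 0) -> analytic_kernel N.
  move=> N0; apply: (@analytic_kernel_of_disc _ (fun _ _ => 0)).
  - by move=> [l z] [m w] [dl _] _; exact: N0.
  - by move=> *; rewrite rmorph0.
  - by move=> *; exact: differentiable_cst.
  - by move=> n x c _; rewrite !big1// => i _; rewrite big1// => j _; rewrite mulr0.
have ak1 : analytic_kernel (NF1 F) by apply: zero_kernel => *; exact: NF1_eq0.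
have ak2 : analytic_kernel (NF2 F) by apply: zero_kernel => *; exact: NF2_eq0.
have ak3 : analytic_kernel (NF3 F).
  apply: (@analytic_kernel_of_disc _
    (fun l m => (1 - (F11 F m)^* * F11 F l) / (1 - m^* * l))).
  - by move=> [l z] [m w] [dl _] [dm _]; exact: NF3E.
  - move=> l m _ _; rewrite fmorph_div !rmorphB !rmorphM !rmorph1 /= !conjCK.
    by rewrite [_ * F11 F m]mulrC [_ * m]mulrC.
  - move=> l m dl dm.
    apply: (@differentiableM _ _ (fun l => 1 - (F11 F m)^* * F11 F l) (szego m)).
      apply: (@differentiableB _ _ _ (fun=> 1 : Cplx R)
        (fun l => (F11 F m)^* * F11 F l)) => //.
      apply: (@differentiableM _ _ (fun=> (F11 F m)^*) (F11 F)) => //.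
      exact: f_diff.
    exact: differentiable_szego (ltW dl).
  - by move=> n x c dx; exact: (pick_matrix_ge0 c f_diff (F11_le1 hF) dx).
have akK : analytic_kernel (Kof (NF1 F) (NF2 F) (NF3 F)).
  apply: (@analytic_kernel_of_disc _ (fun l m => (F11 F m)^* * F11 F l)) => //.
  - by move=> [l z] [m w] [dl _] [dm _]; exact: KofE.
  - by move=> l m _ _; rewrite rmorphM /= conjCK mulrC.
  - move=> l m dl dm.
    apply: (@differentiableM _ _ (fun=> (F11 F m)^*) (F11 F)) => //.
    exact: f_diff.
have rank0 (N : kernelD3 R) :
    (forall l m z w, disc l -> N (l, z) (m, w) = 0) -> rankD3 N 0.
  move=> N0; rewrite /rankD3.
  have -> : on_tridisc N = fun _ _ => 0.
    apply/funext => p; apply/funext => q; rewrite /on_tridisc.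
    have := set_valP p; case: (\val p) => l z [dl _].
    by case: (\val q) => m w; exact: N0.
  exact: kernel_rank0.
split.
- by [].
- by split; apply: rank0 => *; [exact: NF1_eq0 | exact: NF2_eq0].
- split=> // -[l0 dl0 Fl0]; split=> //; rewrite /rankD3.
  have -> : on_tridisc (Kof (NF1 F) (NF2 F) (NF3 F)) =
      fun p q => (F11 F (\val q).1)^* * F11 F (\val p).1.
    apply/funext => p; apply/funext => q; rewrite /on_tridisc.
    have := set_valP p; case: (\val p) => l z [dl _].
    have := set_valP q; case: (\val q) => m w [dm _].
    exact: KofE.
  have t0 : tridisc (l0, (l0, l0)) by [].
  apply: (@kernel_rank1 _ _ (fun p : tridisc (R := R) => F11 F (\val p).1)
    (SigSub (mem_set t0))).
  exact/eqP.
- by move=> l m z w dl dm _ _; split; [exact: NF1_eq0 | exact: NF2_eq0 | exact: NF3E | exact: KofE].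
Qed.
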